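(* Let $A\in\mathbb{R}^{m\times n}$ be an over-determined ($m>n$), full-rank matrix with (nonzero) rows $a_1,\dots,a_m$, let $b\in\mathbb{R}^m$, and let $x^\ast\in\mathbb{R}^n$ satisfy $Ax^\ast=b$. Suppose $x_0\in\mathbb{R}^n$ satisfies $\langle x_0,a_i\rangle=b_i$ for some $i\in[m]$. Let $q$ be such that $\frac1m\le q\le\frac{m-1}{m}$ and $qm$ is an integer, and let $(x_k)_{k\ge 0}$ be the iterates of the reverse quantile-based randomized Kaczmarz method (rqRK) with inputs $A,b,q,x_0$. Then for every $k\ge 0$, $$\mathbb{E}\left[\|x_k-x^\ast\|^2\right]\le\left(1-\frac{\sigma_{\min}^2(A)}{\|A\|_F^2}-\frac{\sigma_{q,\min}^2(A)}{qm}\cdot\frac{\min_{1\le j\le m}\left\{\frac{\|a_j\|^2}{\|A\|_F^2}\right\}}{\max_{1\le j\le m}\{\|a_j\|^2\}}\right)^k\|x_0-x^\ast\|^2.$$ In particular, if $A$ is row-normalized (i.e. $\|a_j\|=1$ for all $j\in[m]$), then $$\mathbb{E}\left[\|x_k-x^\ast\|^2\right]\le\left(1-\frac{\sigma_{\min}^2(A)}{m}-\frac{\sigma_{q,\min}^2(A)}{qm^2}\right)^k\|x_0-x^\ast\|^2.$$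
   Context: Notation: $[m]=\{1,\dots,m\}$; $\|\cdot\|$ is the Euclidean norm and $\|\cdot\|_F$ the Frobenius norm. For $S\subseteq[m]$, $A_S\in\mathbb{R}^{|S|\times n}$ is the submatrix of $A$ formed by the rows indexed by $S$. $\sigma_{\min}(A)$ is the smallest singular value of $A$, i.e. $\sigma_{\min}(A)=\inf_{\|x\|=1}\|Ax\|$. For $\alpha$ with $\alpha m$ an integer, $$\sigma_{\alpha,\min}(A)=\min_{S\subseteq[m],\,|S|=\alpha m}\ \inf_{\|x\|=1}\|A_Sx\|.$$ Quantile convention: for a finite family of real numbers $(s_i)_{i\in I}$ with $I\subset\mathbb{N}$ and $q|I|$ an integer, the $q$-th quantile is the $(q|I|)$-th smallest value. The index set ''$\{i: s_i\le q\text{-th quantile}\}$'' is taken to consist of exactly $q|I|$ indices, namely the first $q|I|$ indices when the indices are ordered by nondecreasing value $s_i$, ties being broken by index order; ''$\{i:s_i>q\text{-th quantile}\}$'' denotes its complement in $I$. Algorithm rqRK (inputs $A,b,q,x_0$): for $k=0,1,2,\dots$, given $x_k$, 1. let $Q$ be the $q$-th quantile of the family $\left(\frac{|\langle x_k,a_j\rangle-b_j|}{\|a_j\|}\right)_{j\in[m]}$; 2. let $S=\left\{j\in[m]:\frac{|\langle x_k,a_j\rangle-b_j|}{\|a_j\|}>Q\right\}$ (with the convention above, so $|S|=m-qm$); 3. select $i\in S$ at random with probability $\frac{\|a_i\|^2}{\|A_S\|_F^2}$ (conditionally on $x_k$, independently of the past); 4. set $x_{k+1}=x_k+\frac{b_i-\langle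 x_k,a_i\rangle}{\|a_i\|^2}a_i$. The expectation is over all the random choices of the algorithm. *)

(* Defs.v *)
From HB Require Import structures.
From mathcomp Require Import all_boot all_order all_algebra.
From mathcomp Require Import all_classical all_reals all_analysis.

Set Implicit Arguments.
Unset Strict Implicit.
Unset Printing Implicit Defensive.

Import Order.TTheory GRing.Theory Num.Theory.

Local Open Scope classical_set_scope.
Local Open Scope ring_scope.

Section LinearAlgebra.
Context {R : realType}.

Definition inner {n : nat} (x y : 'cV[R]_n) : R := \sum_i x i 0 * y i 0.

(* The norm the library puts on matrices and vectors is the sup norm, so the
   Euclidean and Frobenius norms are defined here. *)
Definition enorm {n : nat} (x : 'cV[R]_n) : R := Num.sqrt (inner x x).

Definition fnorm {m n : nat} (A : 'M[R]_(m, n)) : R :=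
  Num.sqrt (\sum_i \sum_j A i j ^+ 2).

(* The rows a_j, as vectors of the same type as the iterates. *)
Definition arow {m n : nat} (A : 'M[R]_(m, n)) (j : 'I_m) : 'cV[R]_n :=
  (row j A)^T.

Definition submatrix {m n : nat} (A : 'M[R]_(m, n)) (S : {set 'I_m}) :
    'M[R]_(#|S|, n) :=
  rowsub (fun i : 'I_#|S| => enum_val i) A.

Definition sigma_min {m n : nat} (A : 'M[R]_(m, n)) : R :=
  inf [set enorm (A *m x) | x in [set x : 'cV[R]_n | enorm x = 1]].

(* The outer infimum ranges over a finite set of values, nonempty as soon as
   0 <= alpha <= 1 and alpha * m is an integer: it is then a minimum. *)
Definition sigma_alpha_min {m n : nat} (alpha : R) (A : 'M[R]_(m, n)) : R :=
  inf [set sigma_min (submatrix A S)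
      | S in [set S : {set 'I_m} | #|S|%:R = alpha * m%:R]].

(* Only used for m > 0, where the range of f is finite and nonempty. *)
Definition min_over {m : nat} (f : 'I_m -> R) : R := inf (range f).
Definition max_over {m : nat} (f : 'I_m -> R) : R := sup (range f).

End LinearAlgebra.

Section Quantile.
Context {R : realType} {m : nat}.

Definition value_index_le (s : 'I_m -> R) : rel 'I_m :=
  fun i j => (s i < s j) || ((s i == s j) && (i <= j)%N).

(* "s_i <= q-th quantile" and "s_i > q-th quantile", with ties at the quantile
   resolved so that the first set has exactly q * m elements; the truncation
   is exact when q * m is a nonnegative integer. *)
Definition below_quantile (q : R) (s : 'I_m -> R) : {set 'I_m} :=
  finset (fun i => i \in take (Num.truncn (q * m%:R))
                              (sort (value_index_le s) (enum 'I_m))).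

Definition above_quantile (q : R) (s : 'I_m -> R) : {set 'I_m} :=
  ~: below_quantile q s.

End Quantile.

Section RqRK.
Context {R : realType} {m n : nat}.
Variables (A : 'M[R]_(m, n)) (b : 'cV[R]_m).

Definition scaled_residual (x : 'cV[R]_n) (j : 'I_m) : R :=
  `|inner x (arow A j) - b j 0| / enorm (arow A j).

Definition admissible_rows (q : R) (x : 'cV[R]_n) : {set 'I_m} :=
  above_quantile q (scaled_residual x).

Definition selection_prob (q : R) (x : 'cV[R]_n) (i : 'I_m) : R :=
  if i \in admissible_rows q x then
    enorm (arow A i) ^+ 2 / fnorm (submatrix A (admissible_rows q x)) ^+ 2
  else 0.

Definition kaczmarz_step (i : 'I_m) (x : 'cV[R]_n) : 'cV[R]_n :=
  x + ((b i 0 - inner x (arow A i)) / enorm (arow A i) ^+ 2) *: arow A i.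

(* The event that the rows selected before time k are those selected along the
   outcome w0.  These events are the atoms of the past at time k, and the
   iterate at time k is constant on each of them. *)
Definition same_past {T : Type} (i : nat -> T -> 'I_m) (k : nat) (w0 : T) :
    set T :=
  [set w | forall l, (l < k)%N -> i l w = i l w0].

(* i k is the random row selected at time k and x k the random iterate.  The
   last clause says that, conditionally on the past at time k, the row i k has
   law selection_prob q (x k). *)
Definition is_rqRK (q : R) (x0 : 'cV[R]_n) {d : measure_display}
    {T : measurableType d} (P : probability T R)
    (i : nat -> T -> 'I_m) (x : nat -> T -> 'cV[R]_n) : Prop :=
  [/\ forall k j, measurable (i k @^-1` [set j]),
      forall w, x 0%N w = x0,
      forall k w, x k.+1 w = kaczmarz_step (i k w) (x k w)
    & forall k w0 j,
        P (same_past i k w0 `&` i k @^-1` [set j]) =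
        (P (same_past i k w0) * (selection_prob q (x k w0) j)%:E)%E].

End RqRK.

(* Main.v *)
Require Import Defs.
From HB Require Import structures.
From mathcomp Require Import all_boot all_order all_algebra.
From mathcomp Require Import all_classical all_reals all_analysis.
From mathcomp Require Import ring lra.

Set Implicit Arguments.
Unset Strict Implicit.
Unset Printing Implicit Defensive.
Import Order.TTheory GRing.Theory Num.Theory.
Local Open Scope classical_set_scope.
Local Open Scope ring_scope.

(** Let t_j be the squared distance from x_k to the j-th hyperplane and
    w_j = |a_j|^2.  One step decreases |x_k - x*|^2 on average by the w-mean of
    t over the admissible rows S.  All values of t on the complement B of S are
    at most Q = max_B t, and all those on S are at least Q, so the mean over S
    exceeds the mean over all rows by at least (sum_B w_j (Q - t_j)) / (sum w_j).
    The row selected at the previous step has t_j = 0, hence this is at least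
    Q * min w_j / sum w_j, and Q is at least the mean of t over B.  The means
    over all rows and over B are bounded below by singular values.

    The iterate is a function of the finitely many possible histories of
    selected rows, so the expectations are finite sums.  The contraction rate
    can be negative (e.g. when n = 1), but then every expectation vanishes. *)

(** * Euclidean geometry of the rows, singular values and extrema over rows *)

Section Inner.
Variable R : realType.

Lemma innerBl n (x y z : 'cV[R]_n) : inner (x - y) z = inner x z - inner y z.
Proof.
by rewrite /inner -sumrB; apply: eq_bigr => i _; rewrite !mxE mulrBl.
Qed.

Lemma innerC n (x y : 'cV[R]_n) : inner x y = inner y x.
Proof. by apply: eq_bigr => i _; rewrite mulrC. Qed.

Lemma innerDZl n (a : R) (x y z : 'cV[R]_n) :
  inner (x + a *: y) z = inner x z + a * inner y z.
Proof.
rewrite /inner mulr_sumr -big_split; apply: eq_bigr => i _.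
by rewrite !mxE mulrDl mulrA.
Qed.

Lemma inner_ge0 n (x : 'cV[R]_n) : 0 <= inner x x.
Proof. by apply: sumr_ge0 => i _; rewrite -expr2 sqr_ge0. Qed.

Lemma sqr_enorm n (x : 'cV[R]_n) : enorm x ^+ 2 = inner x x.
Proof. by rewrite sqr_sqrtr ?inner_ge0. Qed.

Lemma sqr_enorm_eq0 n (x : 'cV[R]_n) : (enorm x ^+ 2 == 0) = (x == 0).
Proof.
rewrite sqr_enorm psumr_eq0; last by move=> i _; rewrite -expr2 sqr_ge0.
apply/allP/eqP => [h|-> i _]; last by rewrite mxE mul0r eqxx implybT.
apply/matrixP => i j; rewrite ord1 mxE.
by have := h i (mem_index_enum i); rewrite /= -expr2 sqrf_eq0 => /eqP.
Qed.

Lemma sqr_enorm_gt0 n (x : 'cV[R]_n) : x != 0 -> 0 < enorm x ^+ 2.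
Proof. by move=> x0; rewrite lt0r sqr_enorm_eq0 x0 sqr_ge0. Qed.

Lemma mulmx_inner m n (A : 'M[R]_(m, n)) (x : 'cV[R]_n) j :
  (A *m x) j 0 = inner x (arow A j).
Proof. by rewrite mxE; apply: eq_bigr => k _; rewrite !mxE mulrC. Qed.

Lemma sqr_enorm_mulmx m n (A : 'M[R]_(m, n)) (x : 'cV[R]_n) :
  enorm (A *m x) ^+ 2 = \sum_j inner x (arow A j) ^+ 2.
Proof.
by rewrite sqr_enorm; apply: eq_bigr => j _; rewrite mulmx_inner expr2.
Qed.

Lemma sqr_fnorm m n (A : 'M[R]_(m, n)) :
  fnorm A ^+ 2 = \sum_j enorm (arow A j) ^+ 2.
Proof.
rewrite sqr_sqrtr; last by do 2!apply: sumr_ge0 => ? _; rewrite sqr_ge0.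
apply: eq_bigr => j _; rewrite sqr_enorm; apply: eq_bigr => k _.
by rewrite !mxE expr2.
Qed.

Lemma arow_submatrix m n (A : 'M[R]_(m, n)) (S : {set 'I_m}) i :
  arow (submatrix A S) i = arow A (enum_val i).
Proof. by apply/matrixP => k l; rewrite !mxE. Qed.

Lemma sqr_enorm_submatrix m n (A : 'M[R]_(m, n)) (S : {set 'I_m}) x :
  enorm (submatrix A S *m x) ^+ 2 = \sum_(j in S) inner x (arow A j) ^+ 2.
Proof.
rewrite sqr_enorm_mulmx [RHS]big_enum_val /=.
by apply: eq_bigr => i _; rewrite arow_submatrix.
Qed.

Lemma sqr_fnorm_submatrix m n (A : 'M[R]_(m, n)) (S : {set 'I_m}) :
  fnorm (submatrix A S) ^+ 2 = \sum_(j in S) enorm (arow A j) ^+ 2.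
Proof.
rewrite sqr_fnorm [RHS]big_enum_val /=.
by apply: eq_bigr => i _; rewrite arow_submatrix.
Qed.

Lemma enormZ n (a : R) (x : 'cV[R]_n) : enorm (a *: x) = `|a| * enorm x.
Proof.
rewrite /enorm -sqrtr_sqr -sqrtrM ?sqr_ge0 //; congr Num.sqrt.
rewrite /inner mulr_sumr; apply: eq_bigr => i _.
by rewrite !mxE mulrACA expr2.
Qed.

Lemma sigma_min_ge0 m n (A : 'M[R]_(m, n)) : 0 <= sigma_min A.
Proof.
rewrite /sigma_min; set E := (X in inf X).
(* For [n = 0] there is no unit vector, and [inf] takes its default value 0. *)
have [->|/set0P E0] := eqVneq E set0; first by rewrite inf0.
by apply: lb_le_inf => // _ [x _ <-]; exact: sqrtr_ge0.
Qed.

(** By homogeneity, scaling [x] to unit norm gives a competitor in the infimum. A vector of norm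
    zero makes the left side vanish, which also covers [n = 0]. *)
Lemma sigma_min_le m n (A : 'M[R]_(m, n)) (x : 'cV[R]_n) :
  sigma_min A * enorm x <= enorm (A *m x).
Proof.
have [x0|x0] := eqVneq (enorm x) 0; first by rewrite x0 mulr0 sqrtr_ge0.
have xp : 0 < enorm x by rewrite lt0r x0 sqrtr_ge0.
rewrite -ler_pdivlMr //; apply: ge_inf.
  by exists 0 => _ [y _ <-]; exact: sqrtr_ge0.
exists ((enorm x)^-1 *: x) => /=.
  by rewrite enormZ ger0_norm ?invr_ge0 ?ltW // mulVf.
by rewrite -scalemxAr enormZ ger0_norm ?invr_ge0 ?ltW // mulrC.
Qed.

Lemma sqr_sigma_min_le m n (A : 'M[R]_(m, n)) (x : 'cV[R]_n) :
  sigma_min A ^+ 2 * enorm x ^+ 2 <= enorm (A *m x) ^+ 2.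
Proof.
rewrite -exprMn lerXn2r ?nnegrE ?mulr_ge0 ?sigma_min_ge0 ?sqrtr_ge0 //.
exact: sigma_min_le.
Qed.

(** The set [S] is itself a competitor: it bounds the outer infimum from above and makes its range
    nonempty, so this infimum is nonnegative and squaring is monotone. *)
Lemma sqr_sigma_alpha_min_le m n (alpha : R) (A : 'M[R]_(m, n))
    (S : {set 'I_m}) (x : 'cV[R]_n) : #|S|%:R = alpha * m%:R ->
  sigma_alpha_min alpha A ^+ 2 * enorm x ^+ 2 <=
  enorm (submatrix A S *m x) ^+ 2.
Proof.
move=> cS; apply: le_trans (sqr_sigma_min_le _ _).
rewrite ler_wpM2r ?sqr_ge0 // lerXn2r ?nnegrE ?sigma_min_ge0 //.
  by apply: lb_le_inf => [|_ [B _ <-]]; [exists (sigma_min (submatrix A S)), S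
    | exact: sigma_min_ge0].
apply: ge_inf; last by exists S.
by exists 0 => _ [B _ <-]; exact: sigma_min_ge0.
Qed.

Lemma min_over_le m (f : 'I_m -> R) j : (forall i, 0 <= f i) ->
  min_over f <= f j.
Proof. by move=> f0; apply: ge_inf; [exists 0 => _ [i _ <-] | exists j]. Qed.

Lemma min_over_ge0 m (f : 'I_m -> R) : (forall i, 0 <= f i) ->
  0 <= min_over f.
Proof.
move=> f0; rewrite /min_over; set E := range f.
have [->|/set0P E0] := eqVneq E set0; first by rewrite inf0.
by apply: lb_le_inf => // _ [x _ <-].
Qed.

Lemma max_over_ge m (f : 'I_m -> R) j : (forall i, 0 <= f i) ->
  f j <= max_over f.
Proof.
move=> f0; apply: ub_le_sup; last by exists j.
(* The values are nonnegative, so their sum bounds each of them. *)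
exists (\sum_i f i) => _ [i _ <-]; rewrite (bigD1 i) //= lerDl.
by apply: sumr_ge0.
Qed.

End Inner.

(** * Index sets below and above a quantile *)

Section Quantile.
Variables (R : realType) (m : nat).
Implicit Types (s : 'I_m -> R) (q : R).

Lemma value_index_le_total s : total (value_index_le s).
Proof.
move=> i j; rewrite /value_index_le.
by case: (ltgtP (s i) (s j)) => //= _; exact: leq_total.
Qed.

Lemma value_index_le_trans s : transitive (value_index_le s).
Proof.
move=> j i k /orP[ij|/andP[/eqP ij lij]] /orP[jk|/andP[/eqP jk ljk]];
  apply/orP.
- by left; apply: lt_trans jk.
- by left; rewrite -jk.
- by left; rewrite ij.
- by right; rewrite ij jk eqxx (leq_trans lij).
Qed.

(** Integrality makes [truncn] exact, and [q <= 1] keeps [take] within the length of the list. *)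
Lemma card_below_quantile q s : 0 <= q -> q <= 1 -> q * m%:R \is a Num.int ->
  #|below_quantile q s|%:R = q * m%:R :> R.
Proof.
move=> q0 q1 qm; rewrite /below_quantile cardsE.
have nat_qm : q * m%:R \is a Num.nat by rewrite natrEint qm mulr_ge0.
rewrite (card_uniqP _) ?take_uniq ?sort_uniq ?enum_uniq //.
rewrite size_takel ?size_sort ?size_enum_ord ?natrK //; first exact: truncnK.
by rewrite -(ler_nat R) truncnK // ler_piMl.
Qed.

(** For a transitive order a sorted list is pairwise ordered, so every element of its [take] part
    precedes every element of its [drop] part. *)
Lemma below_above_quantile q s i j : i \in below_quantile q s ->
  j \in above_quantile q s -> s i <= s j.
Proof.
rewrite /above_quantile /below_quantile !inE.
set r := sort _ _; set k := Num.truncn _ => ik jk.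
have jr : j \in drop k r.
  have : j \in r by rewrite mem_sort mem_enum.
  by rewrite -{1}(cat_take_drop k r) mem_cat (negPf jk).
have := sort_sorted (value_index_le_total s) (enum 'I_m).
rewrite (sorted_pairwise (@value_index_le_trans s)) -/r.
rewrite -{1}(cat_take_drop k r) pairwise_cat => /and3P[/allrelP h _ _].
by have /orP[/ltW//|/andP[/eqP-> _]] := h _ _ ik jr.
Qed.

End Quantile.

(** Let [W] and [W_B] be the total weights of all indices and of [B], let [Q] be the maximum of [t]
    on [B], and [M] the mean over the complement. Then [W * M] exceeds the full sum of [w * t] by
    [W_B * M] minus the sum over [B]. Since [M >= Q], this is at least the sum over [B] of
    [w * (Q - t)], which the zero at [j0] bounds below by [mu * W * Q]. *)
Lemma weighted_average_gap (R : realType) (I : finType) (w t : I -> R)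
    (B : {set I}) (mu : R) (j0 : I) :
  (forall i, 0 < w i) -> (forall i, 0 <= t i) ->
  0 <= mu -> (forall i, mu <= w i / \sum_j w j) ->
  (0 < #|B|)%N -> (0 < #|~: B|)%N ->
  (forall i j, i \in B -> j \in ~: B -> t i <= t j) -> t j0 = 0 ->
  (\sum_j w j * t j) / (\sum_j w j)
    + mu * ((\sum_(j in B) w j * t j) / \sum_(j in B) w j) <=
  (\sum_(j in ~: B) w j * t j) / \sum_(j in ~: B) w j.
Proof.
move=> w0 t0 mu0 muw /card_gt0P[b bB] /card_gt0P[c cB] tB tj0.
have [k kB tk] : exists2 k, k \in B & forall j, j \in B -> t j <= t k.
  by have [k kB tk] := Order.TotalTheory.arg_maxP t bB; exists k.
have splitB (f : I -> R) :
    \sum_j f j = \sum_(j in B) f j + \sum_(j in ~: B) f j.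
  rewrite (bigID (mem B)) /=; congr (_ + _).
  by apply: eq_bigl => j; rewrite inE.
have w_gt0 (D : {set I}) d : d \in D -> 0 < \sum_(j in D) w j.
  move=> dD; rewrite (bigD1 d) //= ltr_pwDl //.
  by apply: sumr_ge0 => j _; exact: ltW.
have WB := w_gt0 _ _ bB; have WC := w_gt0 _ _ cB.
have W0 : 0 < \sum_j w j by rewrite splitB addr_gt0.
have avgB : (\sum_(j in B) w j * t j) / (\sum_(j in B) w j) <= t k.
  rewrite ler_pdivrMr // mulr_sumr; apply: ler_sum => j jB.
  by rewrite mulrC ler_wpM2r ?tk // ltW.
have avgC : t k * (\sum_(j in ~: B) w j) <= \sum_(j in ~: B) w j * t j.
  rewrite mulr_sumr; apply: ler_sum => j jB.
  by rewrite mulrC ler_wpM2l ?tB // ltW.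
have gapB : mu * (\sum_j w j) * t k <= \sum_(j in B) w j * (t k - t j).
  (* If [j0] lies in [B], its own term [w j0 * t k] suffices. Otherwise the value 0 at [j0]
     dominates [t] on [B], so [t] vanishes there. *)
  have [j0B|j0B] := boolP (j0 \in B).
    rewrite [leRHS](bigD1 j0) //= tj0 subr0 -[leLHS]addr0 lerD //.
      by rewrite ler_wpM2r // -ler_pdivlMr.
    by apply: sumr_ge0 => j /andP[jB _]; rewrite mulr_ge0 ?subr_ge0 ?tk // ltW.
  have -> : t k = 0.
    by apply/eqP; rewrite eq_le t0 -tj0 tB // inE.
  rewrite mulr0; apply: sumr_ge0 => j jB; rewrite sub0r.
  have -> : t j = 0 by apply/eqP; rewrite eq_le t0 -tj0 tB // inE.
  by rewrite oppr0 mulr0.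
have {}gapB : mu * (\sum_j w j) * t k + \sum_(j in B) w j * t j <=
    t k * \sum_(j in B) w j.
  rewrite -lerBrDr; apply: le_trans gapB _; rewrite mulr_sumr -sumrB.
  by rewrite le_eqVlt; apply/orP; left; apply/eqP/eq_bigr => j _; ring.
(* The mean over [B] enters only through its upper bound [t k]. *)
apply: le_trans (_ : _ <= (\sum_(j in B) w j * t j
  + \sum_(j in ~: B) w j * t j) / (\sum_j w j) + mu * t k) _.
  by rewrite (splitB (fun j => w j * t j)) lerD2l ler_wpM2l.
rewrite -(ler_pM2r W0) mulrDl divfK ?gt_eqF //.
set M := leRHS; set MC := _ / _ in M *.
have tMC : t k <= MC by rewrite /MC ler_pdivlMr.
have eMC : \sum_(j in ~: B) w j * t j = MC * \sum_(j in ~: B) w j.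
  by rewrite /MC divfK // gt_eqF.
(* Up to the complement's contribution on both sides, the goal is the sum of [gapB] and this
   inequality. *)
have := ler_wpM2r (ltW WB) tMC.
move: gapB; rewrite /M eMC {1 2 3}(splitB w); nra.
Qed.

Definition rqRK_rate (R : realType) m n (A : 'M[R]_(m, n)) (q : R) : R :=
  1 - sigma_min A ^+ 2 / fnorm A ^+ 2
    - sigma_alpha_min q A ^+ 2 / (q * m%:R)
      * (min_over (fun j => enorm (arow A j) ^+ 2 / fnorm A ^+ 2)
         / max_over (fun j => enorm (arow A j) ^+ 2)).

(** * Expected decrease of the error in one step *)

Section Step.
Variables (R : realType) (m n : nat).
Variables (A : 'M[R]_(m, n)) (b : 'cV[R]_m) (xstar : 'cV[R]_n) (q : R).
Hypothesis nonzero_rows : forall j, arow A j != 0.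
Hypothesis solution : A *m xstar = b.

Let w_gt0 j : 0 < enorm (arow A j) ^+ 2.
Proof. exact: sqr_enorm_gt0. Qed.

Lemma residualE (x : 'cV[R]_n) j :
  inner x (arow A j) - b j 0 = inner (x - xstar) (arow A j).
Proof. by rewrite innerBl -(mulmx_inner A xstar) solution. Qed.

(** This provides the zero residual that [expected_kaczmarz_step] requires at the next iterate. *)
Lemma kaczmarz_step_on_hyperplane j (x : 'cV[R]_n) :
  inner (kaczmarz_step A b j x) (arow A j) = b j 0.
Proof.
by rewrite innerDZl -sqr_enorm divfK ?gt_eqF // addrC subrK.
Qed.

(** Pythagoras: the step projects orthogonally onto a hyperplane that contains [xstar]. *)
Lemma sqr_enorm_kaczmarz_step j (x : 'cV[R]_n) :
  enorm (kaczmarz_step A b j x - xstar) ^+ 2 =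
  enorm (x - xstar) ^+ 2
    - inner (x - xstar) (arow A j) ^+ 2 / enorm (arow A j) ^+ 2.
Proof.
rewrite /kaczmarz_step -(opprB (inner x _)) residualE addrAC.
set e := x - xstar; set a := arow A j; set c := _ / _.
rewrite [LHS]sqr_enorm innerDZl !(innerC _ (e + c *: a)) !innerDZl.
rewrite (innerC a e) -!sqr_enorm /c.
by field; rewrite -sqrf_eq0 gt_eqF // w_gt0.
Qed.

Hypothesis q_lower : 1 / m%:R <= q.
Hypothesis q_upper : q <= (m%:R - 1) / m%:R.
Hypothesis q_integral : q * m%:R \is a Num.int.

Lemma expected_kaczmarz_step (x : 'cV[R]_n) :
  (exists j, inner x (arow A j) = b j 0) ->
  \sum_j selection_prob A b q x j
            * enorm (kaczmarz_step A b j x - xstar) ^+ 2 <=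
  rqRK_rate A q * enorm (x - xstar) ^+ 2.
Proof.
move=> [j0 xj0].
have m0 : 0 < m%:R :> R by rewrite ltr0n (leq_ltn_trans _ (ltn_ord j0)).
have qm1 : 1 <= q * m%:R by rewrite -ler_pdivrMr.
have qm2 : q * m%:R <= m%:R - 1 by rewrite -ler_pdivlMr.
have q0 : 0 < q by rewrite -(pmulr_lgt0 _ m0) (lt_le_trans _ qm1).
have q1 : q <= 1.
  by rewrite -(ler_pM2r m0) mul1r (le_trans qm2) // lerBlDr lerDl.
pose w j := enorm (arow A j) ^+ 2.
pose t j := inner (x - xstar) (arow A j) ^+ 2 / w j.
have wt j : w j * t j = inner (x - xstar) (arow A j) ^+ 2.
  by rewrite /t mulrC divfK // gt_eqF // w_gt0.
set s := scaled_residual A b x; set B := below_quantile q s.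
have cB : #|B|%:R = q * m%:R :> R by apply: card_below_quantile => //; exact: ltW.
have cC : #|~: B|%:R = m%:R - q * m%:R :> R.
  by rewrite cardsCs finset.setCK natrB ?max_card // cB card_ord.
have B0 : (0 < #|B|)%N by rewrite -(ltr_nat R) cB (lt_le_trans _ qm1).
(* The bound [q * m <= m - 1] leaves at least one admissible row. *)
have C0 : (0 < #|~: B|)%N by rewrite -(ltr_nat R) cC subr_gt0; lra.
have F0 : 0 < fnorm A ^+ 2.
  rewrite sqr_fnorm (bigD1 j0) //= ltr_pwDl //.
  by apply: sumr_ge0 => j _; exact: ltW.
(* Residuals are nonnegative, so squaring keeps their order and the quantile split of [s] also
   separates the values of [t]. *)
have tE j : t j = s j ^+ 2.
  by rewrite /s /scaled_residual residualE expr_div_n real_normK ?num_real.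
pose mu := min_over (fun j => enorm (arow A j) ^+ 2 / fnorm A ^+ 2).
have w_ge0 j : 0 <= enorm (arow A j) ^+ 2 / fnorm A ^+ 2.
  by rewrite divr_ge0 ?sqr_ge0.
have gap : (\sum_j w j * t j) / (\sum_j w j)
    + mu * ((\sum_(j in B) w j * t j) / \sum_(j in B) w j) <=
    (\sum_(j in ~: B) w j * t j) / \sum_(j in ~: B) w j.
  apply: (@weighted_average_gap _ _ _ _ _ _ j0) => //.
  - by move=> j; rewrite divr_ge0 ?sqr_ge0.
  - exact: min_over_ge0.
  - by move=> j; rewrite -sqr_fnorm; exact: (min_over_le j w_ge0).
  - move=> i j iB jB; rewrite !tE lerXn2r ?nnegrE ?divr_ge0 ?sqrtr_ge0 //.
    exact: (below_above_quantile iB).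
  - by rewrite tE /s /scaled_residual xj0 subrr normr0 mul0r expr0n.
pose mx := max_over (fun j => enorm (arow A j) ^+ 2).
have wmx j : w j <= mx.
  by apply: (@max_over_ge _ _ w) => k; exact: sqr_ge0.
have mx0 : 0 < mx by apply: lt_le_trans (wmx j0); exact: w_gt0.
have avgB : sigma_alpha_min q A ^+ 2 / (q * m%:R) * (enorm (x - xstar) ^+ 2 / mx) <=
    (\sum_(j in B) w j * t j) / \sum_(j in B) w j.
  have WB : 0 < \sum_(j in B) w j.
    have /card_gt0P[j jB] := B0; rewrite (bigD1 j) //= ltr_pwDl //; first exact: w_gt0.
    by apply: sumr_ge0 => k _; rewrite ltW ?w_gt0.
  (* The weights on [B] sum to at most [q * m * mx], because [B] has [q * m] elements. *)
  rewrite mulf_div; apply: le_trans (_ : _ <= sigma_alpha_min q A ^+ 2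
    * enorm (x - xstar) ^+ 2 / \sum_(j in B) w j) _.
    apply: ler_wpM2l; first by rewrite mulr_ge0 ?sqr_ge0.
    rewrite lef_pV2 ?posrE ?mulr_gt0 //.
    rewrite -cB -sumr_const mulr_suml; apply: ler_sum => j _.
    by rewrite mul1r.
  rewrite ler_wpM2r ?invr_ge0 ?(ltW WB) // (eq_bigr _ (fun j _ => wt j)).
  by rewrite -sqr_enorm_submatrix sqr_sigma_alpha_min_le.
have avgA : sigma_min A ^+ 2 / fnorm A ^+ 2 * enorm (x - xstar) ^+ 2 <=
    (\sum_j w j * t j) / (\sum_j w j).
  rewrite -sqr_fnorm mulrAC ler_wpM2r ?invr_ge0 ?sqr_ge0 //.
  by rewrite (eq_bigr _ (fun j _ => wt j)) -sqr_enorm_mulmx sqr_sigma_min_le.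
(* The selection probabilities sum to 1 over the complement of [B], and the decrease for row [j] is
   exactly [t j]. *)
have -> : \sum_j selection_prob A b q x j
            * enorm (kaczmarz_step A b j x - xstar) ^+ 2 =
   enorm (x - xstar) ^+ 2 - (\sum_(j in ~: B) w j * t j) / \sum_(j in ~: B) w j.
  have WC : \sum_(j in ~: B) w j != 0.
    have /card_gt0P[j jB] := C0; rewrite gt_eqF // (bigD1 j) //=.
    by rewrite ltr_pwDl ?sumr_ge0 ?w_gt0 // => k _; rewrite ltW ?w_gt0.
  rewrite (eq_bigr (fun j => if j \in ~: B then
      w j * enorm (x - xstar) ^+ 2 / (\sum_(j in ~: B) w j)
      - w j * t j / (\sum_(j in ~: B) w j) else 0)); last first.
    move=> j _; rewrite /selection_prob /admissible_rows /above_quantile -/s -/B.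
    case: ifP => jB; last by rewrite mul0r.
    by rewrite sqr_fnorm_submatrix sqr_enorm_kaczmarz_step -/(w j) -/(t j); ring.
  by rewrite -big_mkcond sumrB -!mulr_suml mulrAC divff // mul1r.
rewrite /rqRK_rate -/mx -/mu.
have := ler_wpM2l (min_over_ge0 w_ge0) avgB.
rewrite -/mu; lra.
Qed.
End Step.

(** * Expectations as finite sums over histories *)

Section Probability.
Variables (R : realType) (d : measure_display) (T : measurableType d).
Variable P : probability T R.

(** The fibres of [Y] partition the sample space into finitely many measurable pieces, and the
    integrand is constant on each. *)
Lemma expectation_finite_range (V : finType) (Y : T -> V) (g : V -> R) :
  (forall v, measurable (Y @^-1` [set v])) -> (forall v, 0 <= g v) ->
  ('E_P[g \o Y] = (\sum_v g v * fine (P (Y @^-1` [set v])))%R%:E)%E.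
Proof.
move=> mY g0; rewrite unlock -sumEFin.
have coverY : setT = \big[setU/set0]_(v <- index_enum V) (Y @^-1` [set v]).
  by apply/esym/seteqP; split=> // w _; rewrite -bigcup_seq; exists (Y w);
    rewrite /= ?mem_index_enum.
rewrite coverY ge0_integral_bigsetU //.
- apply: eq_bigr => v _.
  rewrite (eq_integral (cst (g v)%:E)); last by move=> w; rewrite inE => /= ->.
  by rewrite integral_cst // EFinM fineK // fin_num_measure.
- exact: index_enum_uniq.
- by move=> u v _ _ [w [/= <- <-]].
- rewrite -coverY; apply/measurable_realfun.measurable_EFinP => _ B _; rewrite setTI.
  have -> : (g \o Y) @^-1` B = \bigcup_(v in [set v | B (g v)]) Y @^-1` [set v].
    by apply/seteqP; split=> [w Bw|w [v Bv /= ->]//]; exists (Y w).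
  by apply: fin_bigcup_measurable => //; exact: finite_finset.
- by move=> w _; rewrite lee_fin; exact: g0.
Qed.

Variables (m n : nat) (A : 'M[R]_(m, n)) (b : 'cV[R]_m) (x0 : 'cV[R]_n) (q : R).
Variables (i : nat -> T -> 'I_m) (x : nat -> T -> 'cV[R]_n).
Hypothesis run : is_rqRK A b q x0 P i x.

(** Tuples of fixed length form a finite type, which makes sums over all pasts finite. *)
Definition history k w : k.-tuple 'I_m := map_tuple (i^~ w) (iota_tuple k 0).

Definition iterate (h : seq 'I_m) : 'cV[R]_n :=
  foldl (fun y j => kaczmarz_step A b j y) x0 h.

Lemma iterate_history k w : x k w = iterate (history k w).
Proof.
have [_ x00 xS _] := run; rewrite /iterate /=.
elim: k => [|k IH]; first exact: x00.
by rewrite xS IH -[k.+1]addn1 iotaD map_cat foldl_cat.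
Qed.

Lemma preimage_historyE k w :
  history k @^-1` [set history k w] = same_past i k w.
Proof.
apply/seteqP; split=> [w' /(congr1 val) /= h l lk|w' /= h].
  have := congr1 (nth (i l w) ^~ l) h.
  by rewrite !(nth_map 0%N) ?size_iota // nth_iota.
apply: val_inj; apply/eq_in_map => l; rewrite mem_iota => /andP[_ lk].
exact: h.
Qed.

(** A nonempty fibre is an atom of the past, hence a finite intersection of events fixing one
    selected row each. *)
Lemma measurable_history k h : measurable (history k @^-1` [set h]).
Proof.
have [mi _ _ _] := run.
have [->|/set0P[w /= <-]] := eqVneq (history k @^-1` [set h]) set0 => //.
rewrite preimage_historyE.
have -> : same_past i k w = \bigcap_(l in [set l | (l < k)%N]) i l @^-1` [set i l w].
  by [].
by apply: fin_bigcap_measurable => //; exact: finite_II.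
Qed.

(** The law in [is_rqRK] is stated along outcomes, hence only for histories that occur; for the
    others the fibre is empty and both sides are 0. *)
Lemma history_row_law k h j :
  fine (P (history k @^-1` [set h] `&` i k @^-1` [set j])) =
  fine (P (history k @^-1` [set h])) * selection_prob A b q (iterate h) j.
Proof.
have [_ _ _ law] := run.
have [->|/set0P[w /= <-]] := eqVneq (history k @^-1` [set h]) set0.
  by rewrite set0I measure0 mul0r.
rewrite preimage_historyE law -iterate_history fineM //.
by rewrite -preimage_historyE fin_num_measure //; exact: measurable_history.
Qed.

Lemma expectation_iterate (g : 'cV[R]_n -> R) k : (forall y, 0 <= g y) ->
  ('E_P[fun w => g (x k w)] =
  (\sum_(h : k.-tuple 'I_m) g (iterate h) * fine (P (history k @^-1` [set h])))%R%:E)%E.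
Proof.
move=> g0; rewrite -(@expectation_finite_range _ _ (fun h : k.-tuple _ => g (iterate h))) //.
  by congr expectation; apply/funext => w; rewrite /= iterate_history.
exact: measurable_history.
Qed.

(** Tower property: the next iterate depends on the pair of past and new row, whose joint law
    factors by [history_row_law]. *)
Lemma expectation_iterateS (g : 'cV[R]_n -> R) k : (forall y, 0 <= g y) ->
  ('E_P[fun w => g (x k.+1 w)] =
  (\sum_(h : k.-tuple 'I_m) (\sum_j selection_prob A b q (iterate h) j
                    * g (kaczmarz_step A b j (iterate h)))
            * fine (P (history k @^-1` [set h])))%R%:E)%E.
Proof.
move=> g0; have [mi _ xS _] := run.
pose Y w := (history k w, i k w).
pose g' (p : k.-tuple 'I_m * 'I_m) := g (kaczmarz_step A b p.2 (iterate p.1)).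
have YE p : Y @^-1` [set p] = history k @^-1` [set p.1] `&` i k @^-1` [set p.2].
  by case: p => h j; apply/seteqP; split=> [w [<- <-]|w /= [<- <-]].
have -> : (fun w => g (x k.+1 w)) = g' \o Y.
  by apply/funext => w; rewrite /= xS iterate_history.
rewrite expectation_finite_range => [|p|p]; last exact: g0.
  congr EFin; under [RHS]eq_bigr => h _ do rewrite mulr_suml.
  rewrite [RHS]pair_bigA; apply: eq_bigr => -[h j] _ /=.
  by rewrite YE history_row_law /g' /=; ring.
by rewrite YE; apply: measurableI => //; exact: measurable_history.
Qed.

Hypothesis nonzero_rows : forall j, arow A j != 0.
Hypothesis x0_on_hyperplane : exists j, inner x0 (arow A j) = b j 0.

(** The witness is the last row of the history, or the one assumed for [x0] if the history is
    empty. *)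
Lemma iterate_on_hyperplane h : exists j, inner (iterate h) (arow A j) = b j 0.
Proof.
case/lastP: h => [//|h j]; exists j.
by rewrite /iterate foldl_rcons kaczmarz_step_on_hyperplane.
Qed.

End Probability.
Theorem theorem1 (R : realType) (m n : nat)
    (A : 'M[R]_(m, n)) (b : 'cV[R]_m) (xstar x0 : 'cV[R]_n) (q : R)
    (d : measure_display) (T : measurableType d) (P : probability T R)
    (i : nat -> T -> 'I_m) (x : nat -> T -> 'cV[R]_n)
    (overdetermined : (n < m)%N)
    (full_rank : \rank A = n)
    (nonzero_rows : forall j : 'I_m, arow A j != 0)
    (solution : A *m xstar = b)
    (x0_on_hyperplane : exists j : 'I_m, inner x0 (arow A j) = b j 0)
    (q_lower : 1 / m%:R <= q)
    (q_upper : q <= (m%:R - 1) / m%:R)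
    (q_integral : q * m%:R \is a Num.int)
    (run : is_rqRK A b q x0 P i x) :
  (forall k : nat,
     ('E_P[fun w => (enorm (x k w - xstar) ^+ 2)%R] <=
      ((1 - sigma_min A ^+ 2 / fnorm A ^+ 2
          - sigma_alpha_min q A ^+ 2 / (q * m%:R)
            * (min_over (fun j => enorm (arow A j) ^+ 2 / fnorm A ^+ 2)
               / max_over (fun j => enorm (arow A j) ^+ 2))) ^+ k
       * enorm (x0 - xstar) ^+ 2)%R%:E)%E) /\
  ((forall j : 'I_m, enorm (arow A j) = 1) ->
   forall k : nat,
     ('E_P[fun w => (enorm (x k w - xstar) ^+ 2)%R] <=
      ((1 - sigma_min A ^+ 2 / m%:R
          - sigma_alpha_min q A ^+ 2 / (q * m%:R ^+ 2)) ^+ k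
       * enorm (x0 - xstar) ^+ 2)%R%:E)%E).

Proof.
have bound k : ('E_P[fun w => (enorm (x k w - xstar) ^+ 2)%R] <=
    (rqRK_rate A q ^+ k * enorm (x0 - xstar) ^+ 2)%R%:E)%E.
  pose p k (h : k.-tuple 'I_m) := fine (P (history i k @^-1` [set h])).
  pose mse k := \sum_(h : k.-tuple 'I_m)
    enorm (iterate A b x0 h - xstar) ^+ 2 * p k h.
  have p_ge0 l h : 0 <= p l h by rewrite fine_ge0.
  have mseE l : ('E_P[fun w => (enorm (x l w - xstar) ^+ 2)%R] = (mse l)%:E)%E.
    rewrite (expectation_iterate run (g := fun y => enorm (y - xstar) ^+ 2)) //.
    by move=> y; exact: sqr_ge0.
  have mseS l : mse l.+1 <= rqRK_rate A q * mse l.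
    rewrite -lee_fin -mseE.
    rewrite (expectation_iterateS run (g := fun y => enorm (y - xstar) ^+ 2));
      last by move=> y; exact: sqr_ge0.
    rewrite lee_fin mulr_sumr; apply: ler_sum => h _; rewrite mulrA.
    apply: ler_wpM2r; first exact: p_ge0.
    by apply: expected_kaczmarz_step => //; exact: iterate_on_hyperplane.
  have mse0 : mse 0%N = enorm (x0 - xstar) ^+ 2.
    have [_ x00 _ _] := run.
    apply/EFin_inj; rewrite -mseE.
    under eq_fun do rewrite x00.
    exact: expectation_cst.
  have mse_ge0 l : 0 <= mse l.
    by apply: sumr_ge0 => h _; rewrite mulr_ge0 ?sqr_ge0.
  (* Iterating [mseS] multiplies inequalities by the rate, which requires it to be nonnegative. *)
  rewrite mseE lee_fin -mse0; have [rate_ge0|rate_lt0] := leP 0 (rqRK_rate A q).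
    elim: k => [|k IH]; first by rewrite mul1r.
    by rewrite (le_trans (mseS k)) // exprS -mulrA ler_wpM2l.
  (* Here [0 <= mse l.+1 <= rate * mse l] with a negative rate forces [mse l = 0], including
     [l = 0], so both sides of the bound vanish. *)
  have mse_eq0 l : mse l = 0.
    apply/eqP; rewrite eq_le mse_ge0 andbT -(nmulr_rge0 _ rate_lt0).
    exact: le_trans (mseS l).
  by rewrite !mse_eq0 mulr0.
split=> [|normalized k]; first exact: bound.
have m0 : (0 < m)%N by case: x0_on_hyperplane => j _; exact: leq_ltn_trans (ltn_ord j).
apply: le_trans (bound k) _; rewrite lee_fin /rqRK_rate.
have fA : fnorm A ^+ 2 = m%:R.
  rewrite sqr_fnorm; under eq_bigr => j _ do rewrite normalized expr1n.
  by rewrite sumr_const card_ord.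
(* With unit rows both extrema are over constant functions; [m > 0] makes their ranges singletons
   rather than empty. *)
have range_cst (c : R) : range (fun _ : 'I_m => c) = [set c].
  by apply/seteqP; split=> [_ [j _ <-]//|_ ->]; exists (Ordinal m0).
rewrite fA /min_over /max_over.
under [X in inf (range X)]eq_fun do rewrite normalized expr1n.
under [X in sup (range X)]eq_fun do rewrite normalized expr1n.
rewrite !range_cst inf1 sup1 divr1 mul1r -(mulrA _ (q * _)^-1) -invfM.
by rewrite -[_ * m%:R * _]mulrA -expr2.
Qed.
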